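(* $\mathbf{Top}_{\mathsf{QAlgS}}=\mathbf{Top}_{\mathsf{QConS}}=\mathbf{Top}_{\mathbb D}$, where $\mathsf{QAlgS}$ is the class of all quasialgebraic spaces, $\mathsf{QConS}$ the class of all quasicontinuous (i.e. locally hypercompact) spaces, and $\mathbb D$ the class of all one-point convergence spaces.
   Context: All spaces are $T_0$; $\mathbf{Top}$ is the category of $T_0$ spaces and continuous maps. For a class $\mathbb C$ of $T_0$ spaces, a subset $U$ of a space $X$ is $\mathbb C$-open if $k^{-1}(U)$ is open in $C$ for every $C\in\mathbb C$ and every continuous map $k:C\to X$; $X$ is $\mathbb C$-generated if every $\mathbb C$-open subset is open; $\mathbf{Top}_{\mathbb C}$ is the full subcategory of $\mathbf{Top}$ of $\mathbb C$-generated spaces. In a space $X$, with specialization order $x\sqsubseteq y$ iff $x\in\overline{\{y\}}$, write $\uparrow F=\{z\in X:\exists a\in F,\ a\sqsubseteq z\}$. $X$ is locally hypercompact (also called quasicontinuous) if for every open $U$ and $x\in U$ there is a finite $F\subseteq X$ with $x\in\mathrm{int}(\uparrow F)\subseteq\uparrow F\subseteq U$. $X$ is quasialgebraic if for every open $U$ and $x\in U$ there is a finite $F\subseteq X$ with $x\in\mathrm{int}(\uparrow F)=\uparrow F\subseteq U$. One-point convergence spaces are the spaces $(D\cup\{\infty\},\beta_D)$, where $D$ is a (non-empty) directed poset, $\infty\notin D$, and $\beta_D$ is the topology with subbase all sets $\uparrow x$ and $\uparrow x\cup\{\infty\}$, $x\in D$, with $\uparrow x=\{y\in D:x\le y\}$.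 ($\mathbf{Top}_{\mathbb D}$ is the category of monotone determined spaces.) *)

(* Defs.v *)
From HB Require Import structures.
From mathcomp Require Import all_boot all_order.
From mathcomp Require Import boolp classical_sets functions cardinality topology.

Set Implicit Arguments.
Unset Strict Implicit.
Unset Printing Implicit Defensive.

Local Open Scope classical_set_scope.

(* A topologicalType need not be T0, so the classes of T0 spaces below include
   T0 explicitly, except for the one-point convergence spaces, where it is
   automatic: D is a poset, and oo lies outside every principal upper set. *)
Definition space_class := topologicalType -> Prop.

Definition class_open (CC : space_class) (X : topologicalType) (U : set X) :=
  forall (C : topologicalType) (k : C -> X),
    CC C -> continuous k -> open (k @^-1` U).

Definition generated (CC : space_class) (X : topologicalType) :=
  forall U : set X, class_open CC U -> open U.

(* A full subcategory of the category of T0 spaces is determined by, and here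
   represented by, its class of objects. *)
Definition Top_gen (CC : space_class) : space_class :=
  fun X => kolmogorov_space X /\ generated CC X.

Definition specialization (X : topologicalType) (x y : X) : Prop :=
  closure [set y] x.

Definition up_closure (X : topologicalType) (F : set X) : set X :=
  [set z | exists2 a, F a & specialization a z].

Definition locally_hypercompact (X : topologicalType) :=
  forall (U : set X) (x : X), open U -> U x ->
    exists F : set X, [/\ finite_set F,
      interior (up_closure F) x,
      interior (up_closure F) `<=` up_closure F &
      up_closure F `<=` U].

Definition quasialgebraic (X : topologicalType) :=
  forall (U : set X) (x : X), open U -> U x ->
    exists F : set X, [/\ finite_set F,
      interior (up_closure F) x,
      interior (up_closure F) = up_closure F &
      up_closure F `<=` U].

Definition QConS : space_class :=
  fun X => kolmogorov_space X /\ locally_hypercompact X.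

Definition QAlgS : space_class :=
  fun X => kolmogorov_space X /\ quasialgebraic X.

Definition directed_poset d (D : porderType d) : Prop :=
  [set: D] !=set0 /\
  forall x y : D, exists z : D, (x <= z)%O /\ (y <= z)%O.

(* [Some x] stands for x in D, and [None] for the added point oo. *)
Definition one_point_conv d (D : porderType d) : Type := option D.

Section OnePointConvergence.
Context {d : Order.disp_t} (D : porderType d).
Local Notation T := (one_point_conv D).

Definition principal_up (x : D) : set T :=
  [set Some y | y in [set y : D | (x <= y)%O]].

Definition one_point_subbase : set (set T) :=
  [set U | exists x : D, U = principal_up x \/ U = principal_up x `|` [set None]].

HB.instance Definition _ := Choice.copy T (option D).
HB.instance Definition _ :=
  @isSubBaseTopological.Build T (set T) one_point_subbase id.

End OnePointConvergence.

Definition homeomorphic (X Y : topologicalType) : Prop :=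
  exists (f : X -> Y) (g : Y -> X),
    [/\ continuous f, continuous g, cancel f g & cancel g f].

(* As the carrier of D and the point oo are arbitrary, the class of one-point
   convergence spaces is closed under homeomorphism. *)
Definition one_point_convergence_space : space_class :=
  fun X => exists (d : Order.disp_t) (D : porderType d),
    directed_poset D /\ homeomorphic X (one_point_conv D).

(* Main.v *)
Require Import Defs.
From HB Require Import structures.
From mathcomp Require Import all_boot all_order.
From mathcomp Require Import boolp classical_sets cardinality topology.

Set Implicit Arguments.
Unset Strict Implicit.
Unset Printing Implicit Defensive.

Import Order.POrderTheory.
Local Open Scope classical_set_scope.

(** Continuous maps compose, so if every member of a class is generated by
    another class, then every space generated by the first class is generated by
    the second ([Top_gen_mono]). Each of the inclusions is obtained in this way.

    One-point convergence spaces are quasialgebraic: a point [Some x] has the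
    least neighbourhood [principal_up x], and [None] has the basic
    neighbourhoods [principal_up x] with [None] added, which are the upper closures of
    [{Some x, None}]. Quasialgebraic spaces are locally hypercompact. So the
    theorem comes down to one fact: a locally hypercompact [T0] space [X] is
    generated by one-point convergence spaces.

    A continuous map from a one-point convergence space to [X] amounts to a
    monotone net in [X], for the specialization order, with a chosen limit.
    Thus a set [U] that is open for the one-point convergence spaces meets every
    directed set that converges to a point of [U] ([directed_limit_meets]); in
    particular [U] is an upper set. Let [x] be in [U] and suppose that no finite
    [F] with [x] in the interior of its upper closure is contained in [U]. These
    sets [F] form a filtered family in the Smyth preorder, so Rudin's lemma
    ([rudin]) gives a directed set that avoids [U] and meets every [F]. By local
    hypercompactness it converges to [x], a contradiction. So some [F] is
    contained in [U], and the interior of its upper closure is a neighbourhood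
    of [x] inside [U]. *)

(** * Directed sets and Rudin's lemma *)

(** Passage from bounds of single elements to a common bound of finitely many.
    It serves twice: for a finite set covered by a chain of sets, and for finite
    intersections of subbasic neighbourhoods. *)
Lemma finite_common_bound (I : Type) (J : eqType) (B : set I) (E : set J)
    (R : J -> I -> Prop) :
  finite_set E -> B !=set0 ->
  (forall i j, B i -> B j ->
     exists2 k, B k & forall e, R e i \/ R e j -> R e k) ->
  (forall e, E e -> exists2 i, B i & R e i) ->
  exists2 i, B i & forall e, E e -> R e i.
Proof.
move=> /finite_seqP[s ->] [i0 Bi0] dirB.
elim: s => [|e s IHs] bound; first by exists i0.
have [i Bi Ri] : exists2 i, B i & R e i by apply: bound; rewrite /= mem_head.
have [j Bj Rj] : exists2 j, B j & forall e', [set` s] e' -> R e' j.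
  by apply: IHs => e' /= e's; apply: bound; rewrite /= in_cons e's orbT.
have [k Bk Rk] := dirB _ _ Bi Bj.
exists k => // e' /=; rewrite in_cons => /orP[/eqP->|e's]; apply: Rk.
- by left.
- by right; apply: Rj.
Qed.

(** Rudin's lemma. The directed set [A] is a minimal lower set among those that
    avoid [U] and meet every member of [FF]. For [x] in [A], the points of [A]
    that are not above [x] form a smaller lower set, which by minimality misses
    some [F] in [FF]: all points of [F] in [A] are above [x]. Likewise all points
    of some [G] in [A] are above [y]. A member of [FF] above [F] and [G] meets
    [A], in a point above [x] and [y]. Minimality comes from Zorn's lemma,
    applied to the complements: a finite [F] contained in the union of a chain is
    contained in a member of the chain. *)
Lemma rudin (T : choiceType) (le : T -> T -> Prop) (FF : set (set T))
    (U : set T) :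
  (forall x, le x x) -> (forall x y z, le x y -> le y z -> le x z) ->
  (forall x y, le x y -> U x -> U y) ->
  FF !=set0 -> (forall F, FF F -> finite_set F) ->
  (forall F G, FF F -> FF G -> exists2 H, FF H &
     forall h, H h -> (exists2 f, F f & le f h) /\ (exists2 g, G g & le g h)) ->
  (forall F, FF F -> ~ F `<=` U) ->
  exists A : set T, [/\ A !=set0,
    forall x y, A x -> A y -> exists z, [/\ A z, le x z & le y z],
    forall x, A x -> ~ U x &
    forall F, FF F -> exists2 a, F a & A a].
Proof.
move=> lexx tr Uup [F0 FF0] FFfin FFdir FFU.
pose P (V : set T) := (forall x y, le x y -> V x -> V y) /\
  forall F, FF F -> ~ F `<=` V `|` U.
have [C CP Ctot|V [[Vup PV] Vmax]] := @Zorn_bigcup T P.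
  split.
    by move=> x y xy [V CV Vx]; exists V => //; apply: (CP V CV).1 xy Vx.
  move=> F FFF FC.
  (* Adding [set0] keeps the bound available for the empty chain. *)
  have [|||V [CV|->] FV] := @finite_common_bound (set T) T
    [set V | C V \/ V = set0] F (fun t V => (V `|` U) t) (FFfin F FFF).
  - by exists set0; right.
  - move=> V W [CV|->] [CW|->]; last 3 first.
    + by exists V; [left|move=> e [//|[//|]]; right].
    + by exists W; [left|move=> e [[//|]|//]; right].
    + by exists set0; [right|move=> e [|]].
    have [VW|WV] := Ctot V W CV CW.
    + by exists W; [left|move=> e [[/VW|]|//]; [left|right]].
    + by exists V; [left|move=> e [//|[/WV|]]; [left|right]].
  - move=> e /FC[[V CV Ve]|Ue]; first by exists V; left.
    by exists set0; right.
  - exact: (CP V CV).2 F FFF FV.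
  - by apply: (FFU F FFF) => t /FV[].
pose A := ~` (V `|` U).
have Amiss x : A x -> exists2 F, FF F &
    forall f, F f -> A f -> le x f.
  move=> Ax; apply: contrapT => noF.
  apply: (Vmax (V `|` [set y | le x y])).
    split; first by move=> y Vy; left.
    by move=> /(_ x (or_intror (lexx x))) Vx; apply: Ax; left.
  split; first move=> y z yz [Vy|xy]; first by left; apply: Vup yz Vy.
  - by right; apply: tr xy yz.
  - move=> F FFF FV; apply: noF; exists F => // f Ff Af.
    by have [[Vf|//]|Uf] := FV f Ff; case: Af; [left|right].
have meetA F : FF F -> exists2 a, F a & A a.
  move=> FFF; apply: contrapT => noa; apply: (PV F FFF) => t Ft.
  by apply: contrapT => At; apply: noa; exists t.
have Alow x y : le x y -> A y -> A x.
  by move=> xy Ay [Vx|Ux]; apply: Ay; [left; apply: Vup Vx|right; apply: Uup Ux].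
exists A; split => //.
- by have [a _ Aa] := meetA F0 FF0; exists a.
- move=> x y /Amiss[F FFF Fx] /Amiss[G FFG Gy].
  have [H FFH HFG] := FFdir F G FFF FFG.
  have [h Hh Ah] := meetA H FFH; have [[f Ff fh] [g Gg gh]] := HFG h Hh.
  exists h; split=> //.
  + by apply: (tr x f) => //; apply: Fx => //; apply: Alow fh Ah.
  + by apply: (tr y g) => //; apply: Gy => //; apply: Alow gh Ah.
- by move=> x Ax Ux; apply: Ax; right.
Qed.

(** * The specialization order *)

Lemma specializationP (X : topologicalType) (x y : X) :
  specialization x y <-> forall V, open V -> V x -> V y.
Proof.
split=> [xy V oV Vx|H V].
  by have [z [-> /= ]] := xy V (open_nbhs_nbhs (conj oV Vx)).
rewrite nbhsE => -[W [oW Wx] WV].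
by exists y; split=> //; apply: WV (H W oW Wx).
Qed.

Lemma specialization_refl (X : topologicalType) (x : X) : specialization x x.
Proof. by apply/specializationP. Qed.

Lemma specialization_trans (X : topologicalType) (x y z : X) :
  specialization x y -> specialization y z -> specialization x z.
Proof.
move=> /specializationP xy /specializationP yz; apply/specializationP => V oV Vx.
exact: yz oV (xy V oV Vx).
Qed.

Lemma specialization_anti (X : topologicalType) (x y : X) :
  kolmogorov_space X -> specialization x y -> specialization y x -> x = y.
Proof.
move=> X0 xy yx; apply/eqP; apply: contrapT => /negP/X0[V].
rewrite !inE => -[[+ Vy]|[+ Vx]]; rewrite nbhsE => -[W [oW Ww] WV].
- by apply: Vy; apply: WV; apply: (specializationP x y).1 xy W oW Ww.
- by apply: Vx; apply: WV; apply: (specializationP y x).1 yx W oW Ww.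
Qed.

(** The proof that [X] is [T0] is a parameter of the type because antisymmetry
    of the order below depends on it. *)
Definition spec_sub (X : topologicalType) (X0 : kolmogorov_space X)
  (A : set X) : Type := {x : X | A x}.

Section SpecSub.
Variables (X : topologicalType) (X0 : kolmogorov_space X) (A : set X).
Local Notation D := (spec_sub X0 A).

HB.instance Definition _ := gen_eqMixin D.
HB.instance Definition _ := gen_choiceMixin D.

Definition spec_le (a b : D) : bool := `[< specialization (sval a) (sval b) >].

Fact spec_le_refl : reflexive spec_le.
Proof. by move=> a; apply/asboolP/specialization_refl. Qed.

Fact spec_le_anti : antisymmetric spec_le.
Proof.
move=> a b /andP[/asboolP ab /asboolP ba].
exact/eq_sig_hprop/specialization_anti.
Qed.

Fact spec_le_trans : transitive spec_le.
Proof.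
move=> b a c /asboolP ab /asboolP bc; apply/asboolP.
exact: specialization_trans ab bc.
Qed.

HB.instance Definition _ := Order.Le_isPOrder.Build (Order.Disp tt tt) D
  spec_le_refl spec_le_anti spec_le_trans.

End SpecSub.

(** * One-point convergence spaces *)

Section OnePoint.
Context {d : Order.disp_t} (D : porderType d).
Hypothesis dirD : directed_poset D.
Local Notation T := (one_point_conv D).

(** The sets on the right are closed under unions and, as [D] is directed, under
    finite intersections, so they form the topology generated by the subbase. *)
Lemma open_one_point (U : set T) : open U <->
  (forall x y : D, (x <= y)%O -> U (Some x) -> U (Some y)) /\
  (U None -> exists x : D, principal_up x `<=` U).
Proof.
split=> [[EE EEsub <-]|[Uup UN]].
  have subbasic (V : set T) : V \in @one_point_subbase d D ->
      (forall x y : D, (x <= y)%O -> V (Some x) -> V (Some y)) /\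
      (V None -> exists x : D, principal_up x `<=` V).
    have up (a x y : D) : (x <= y)%O -> principal_up a (Some x) ->
        principal_up a (Some y).
      move=> xy [z az [zx]]; exists y => //=.
      by apply: le_trans az _; rewrite zx.
    move=> /set_mem[a [->|->]]; split; first exact: up.
    - by case.
    - by move=> x y xy [/(up _ _ _ xy)|//]; left.
    - by exists a => t; left.
  have basic B : EE B ->
      (forall x y : D, (x <= y)%O -> B (Some x) -> B (Some y)) /\
      (B None -> exists x : D, principal_up x `<=` B).
    move=> /EEsub[S Ssub <-]; split=> [x y xy Bx V VS|BN].
      exact: (subbasic V (Ssub V VS)).1 x y xy (Bx V VS).
    have [||V VS|x _ xS] := finite_common_bound (B := [set: D])
      (R := fun V x => principal_up x `<=` V) (finite_fset S).
    - by have [x _] := dirD.1; exists x.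
    - move=> x y _ _; have [z [xz yz]] := dirD.2 x y; exists z => // V [|] H.
      + by move=> _ [t zt <-]; apply: H; exists t => //=; apply: le_trans zt.
      + by move=> _ [t zt <-]; apply: H; exists t => //=; apply: le_trans zt.
    - by have [x] := (subbasic V (Ssub V VS)).2 (BN V VS); exists x.
    - by exists x => t xt V VS; apply: (xS V VS).
  split=> [x y xy [B EB Bx]|[B EB BN]].
    by exists B => //; apply: (basic B EB).1 xy Bx.
  by have [x xB] := (basic B EB).2 BN; exists x => t /xB; exists B.
have subbase_open (V : set T) : one_point_subbase V -> open V.
  move=> VS; exists [set V]; last by rewrite bigcup_set1.
  by move=> _ ->; apply: (finI_from1 id).
have oup (x : D) : open (principal_up x : set T).
  by apply: subbase_open; exists x; left.
have oupN (x : D) : open (principal_up x `|` [set None] : set T).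
  by apply: subbase_open; exists x; right.
rewrite openE => -[x|] Ux; rewrite /interior/= nbhsE.
  exists (principal_up x); first by split; [exact: oup|exists x => //=].
  by move=> _ [y xy <-]; apply: Uup xy Ux.
have [x xU] := UN Ux; exists (principal_up x `|` [set None]).
  by split; [exact: oupN|right].
by move=> t [/xU|->].
Qed.

Lemma open_principal_up (x : D) : open (principal_up x : set T).
Proof.
apply/open_one_point; split=> [y z yz [t xt [ty]]|[]//].
by exists z => //=; apply: le_trans xt _; rewrite ty.
Qed.

Lemma one_point_kolmogorov : kolmogorov_space T.
Proof.
have sep (x : D) (q : T) : ~ principal_up x q ->
    principal_up x \in nbhs (Some x : T) /\ q \in ~` (principal_up x : set T).
  move=> xq; rewrite !inE; split=> //; apply: open_nbhs_nbhs.
  by split; [exact: open_principal_up|exists x => /=].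
move=> [x|] [y|] // xNy; last 2 first.
- by exists (principal_up x); left; apply: sep => -[].
- by exists (principal_up y); right; apply: sep => -[].
have [xy|xy] := boolP (x <= y)%O; last first.
  exists (principal_up x); left; apply: sep => -[z xz [zy]].
  by move: xy; rewrite -zy xz.
exists (principal_up y); right; apply: sep => -[z yz [zx]].
by move/eqP: xNy; apply; congr Some; apply/le_anti; rewrite xy -zx yz.
Qed.

(** If the upper closure contains [None], then [principal_up x] provides the
    required neighbourhood of [None]. *)
Lemma open_up_closure (F : set T) (x : D) :
  F (Some x) -> open (up_closure F).
Proof.
have spec (y z : D) : (y <= z)%O -> specialization (Some y : T) (Some z).
  move=> yz; apply/specializationP => V /open_one_point[Vup _].
  exact: Vup yz.
move=> Fx; apply/open_one_point; split=> [y z yz [a Fa ay]|_].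
  by exists a => //; apply: specialization_trans ay (spec y z yz).
by exists x => _ [y xy <-]; exists (Some x) => //; apply: spec.
Qed.

Lemma one_point_quasialgebraic : quasialgebraic T.
Proof.
move=> U p oU Up.
have [x Ux] : exists x : D, U (Some x).
  case: p Up => [x|] Up; first by exists x.
  have [x xU] := ((open_one_point U).1 oU).2 Up.
  by exists x; apply: xU; exists x => /=.
pose F : set T := [set Some x; p].
have oF : open (up_closure F) by apply: (@open_up_closure _ x); left.
have Fp : up_closure F p.
  by exists p; [right|exact: specialization_refl].
exists F; split.
- by rewrite finite_setU; split; exact: finite_set1.
- by rewrite (interior_id _).1.
- exact: (interior_id _).1.
- move=> q [a Fa /specializationP aq]; apply: aq oU _.
  by case: Fa => ->.
Qed.

End OnePoint.

(** * Generated spaces *)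

Lemma generated_member (CC : space_class) (C : topologicalType) :
  CC C -> generated CC C.
Proof. by move=> CCC U oU; apply: (oU C id CCC) => x. Qed.

Lemma generated_homeomorphic (CC : space_class) (X Y : topologicalType) :
  CC Y -> homeomorphic X Y -> generated CC X.
Proof.
move=> CCY [f [g [cf cg fK gK]]] U oU.
have -> : U = f @^-1` (g @^-1` U) by apply/funext => x /=; rewrite fK.
by apply: open_comp; [move=> x _; exact: cf|exact: oU].
Qed.

Lemma Top_gen_mono (CC CC' : space_class) :
  (forall C, CC C -> generated CC' C) ->
  forall X, Top_gen CC X -> Top_gen CC' X.
Proof.
move=> gen X [X0 genX]; split=> // U oU; apply: genX => C k CCC ck.
apply: (gen C CCC) => C' k' CC'C' ck'.
apply: (oU C' (k \o k')) => // x.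
by apply: continuous_comp; [exact: ck'|exact: ck].
Qed.

(** * Locally hypercompact spaces are monotone determined *)

(** The directed set is the image of a monotone net, and [None] is sent to its
    limit [x]; the preimage of [U] is then a neighbourhood of [None], which
    contains points of the net. *)
Lemma directed_limit_meets (X : topologicalType) (X0 : kolmogorov_space X)
    (U A : set X) (x : X) :
  class_open one_point_convergence_space U -> U x -> A !=set0 ->
  (forall a b, A a -> A b ->
     exists c, [/\ A c, specialization a c & specialization b c]) ->
  (forall V, open V -> V x -> exists2 a, A a & V a) ->
  exists2 a, A a & U a.
Proof.
move=> oU Ux [a0 Aa0] dirA limA.
pose D := spec_sub X0 A.
have dirD : directed_poset D.
  split; first by exists (exist _ a0 Aa0).
  move=> [a Aa] [b Ab]; have [c [Ac ac bc]] := dirA a b Aa Ab.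
  by exists (exist _ c Ac); split; apply/asboolP.
pose k (p : one_point_conv D) : X := if p is Some a then sval a else x.
have ck : continuous k.
  apply/continuousP => V oV; apply/(open_one_point dirD); split.
    by move=> a b /asboolP/specializationP ab; apply: ab.
  move=> Vx; have [a Aa Va] := limA V oV Vx.
  exists (exist _ a Aa) => _ [b /asboolP/specializationP ab <-].
  exact: ab oV Va.
have [|_ /(_ Ux)[a aU]] := (open_one_point dirD (k @^-1` U)).1.
  apply: oU ck; exists _, D; split=> //.
  by exists id, id; split=> // p.
by exists (sval a); [exact: svalP|apply: (aU (Some a)); exists a => /=].
Qed.

Lemma locally_hypercompact_generated (X : topologicalType) :
  QConS X -> generated one_point_convergence_space X.
Proof.
move=> [X0 hcX] U oU.
have Uup x y : specialization x y -> U x -> U y.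
  move=> xy Ux.
  have [|a b -> ->|V oV Vx|_ -> //] :=
    @directed_limit_meets X X0 U [set y] x oU Ux.
  - by exists y.
  - by exists y; split=> //; exact: specialization_refl.
  - by exists y => //; apply: (specializationP x y).1 xy V oV Vx.
rewrite openE => x Ux; rewrite /interior /=.
(* On [FF], the Smyth preorder is containment of upper closures; it is
   filtered because an open neighbourhood of [x] contains the upper closure of a
   member of [FF], by local hypercompactness. *)
pose FF : set (set X) := [set F | finite_set F /\ interior (up_closure F) x].
suff [F [_ xF] FU] : exists2 F, FF F & F `<=` U.
  by apply: filterS xF => y [a /FU Ua ay]; apply: Uup ay Ua.
apply: contrapT => noF.
have approx V : open V -> V x -> exists2 F, FF F & up_closure F `<=` V.
  by move=> oV Vx; have [F [Ffin xF _ FV]] := hcX V x oV Vx; exists F.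
have [|F [] //|F G [_ xF] [_ xG]|F FFF FU|A [A0 dirA AU meetA]] :=
  @rudin X (@specialization X) FF U (@specialization_refl X)
    (@specialization_trans X) Uup.
- by have [F FFF _] := approx setT openT I; exists F.
- have [|//|H FFH HV] :=
    approx (interior (up_closure F) `&` interior (up_closure G)).
    by apply: openI; exact: open_interior.
  exists H => // h Hh.
  have [/interior_subset ? /interior_subset ?] :
      (interior (up_closure F) `&` interior (up_closure G)) h.
    by apply: HV; exists h => //; exact: specialization_refl.
  by [].
- by apply: noF; exists F.
have [|a Aa Ua] := directed_limit_meets X0 oU Ux A0 dirA.
  move=> V oV Vx; have [F FFF FV] := approx V oV Vx.
  have [a Fa Aa] := meetA F FFF; exists a => //.
  by apply: FV; exists a => //; exact: specialization_refl.
exact: AU a Aa Ua.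
Qed.

(** * The coincidence of the three categories *)

Theorem theorem39 :
  Top_gen QAlgS = Top_gen QConS /\
  Top_gen QConS = Top_gen one_point_convergence_space.
Proof.
have one_point_QAlgS :
    forall X, Top_gen one_point_convergence_space X -> Top_gen QAlgS X.
  apply: Top_gen_mono => X [d [D [dirD XD]]].
  apply: generated_homeomorphic XD; split.
  - exact: one_point_kolmogorov.
  - exact: one_point_quasialgebraic.
have QAlgS_QConS : forall X, Top_gen QAlgS X -> Top_gen QConS X.
  apply: Top_gen_mono => X [X0 qaX]; apply: generated_member.
  split=> // U x oU Ux; have [F [Ffin xF FE FU]] := qaX U x oU Ux.
  by exists F; split=> //; rewrite FE.
have QConS_one_point :
    forall X, Top_gen QConS X -> Top_gen one_point_convergence_space X.
  by apply: Top_gen_mono => X; exact: locally_hypercompact_generated.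
split; apply/funext => X; apply/propext; split.
- exact: QAlgS_QConS.
- by move=> /QConS_one_point; exact: one_point_QAlgS.
- exact: QConS_one_point.
- by move=> /one_point_QAlgS; exact: QAlgS_QConS.
Qed.
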